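(* Let $G$ be an indecomposable graph with $v(G)\geq 6$, and let $a\neq b\in V(G)$. If $\mathbb{I}(G)$ is $\{a,b\}$-covered, then $G$ contains an $\{a,b\}$-minimal induced subgraph of cardinality $v(G)$, $v(G)-1$, $v(G)-3$ or $v(G)-5$; that is, there is $X\subseteq V(G)$ with $a,b\in X$ and $|X|\in\{v(G),v(G)-1,v(G)-3,v(G)-5\}$ such that $G[X]$ is $\{a,b\}$-minimal.
   Context: Graphs are finite, simple and undirected; $v(G)=|V(G)|$, and $G[X]$ is the subgraph induced by $X\subseteq V(G)$. A subset $I\subseteq V(G)$ is an interval of $G$ if every vertex outside $I$ is adjacent to all or to none of the vertices of $I$. The sets $\emptyset$, $V(G)$ and $\{x\}$ ($x\in V(G)$) are the trivial intervals. $G$ is indecomposable if all its intervals are trivial, and decomposable otherwise. For an indecomposable graph $G=(V,E)$, the indecomposability graph $\mathbb{I}(G)$ has vertex set $V$, and its edges are the pairs $\{x,y\}$ of distinct vertices such that $G[V\setminus\{x,y\}]$ is indecomposable. A graph $H$ is $X$-covered, for $X\subseteq V(H)$, if $X$ is a vertex cover of $H$, i.e. every edge of $H$ meets $X$. Given two distinct vertices $x,y$ of an indecomposable graph $G$ with $v(G)\ge 4$, $G$ is $\{x,y\}$-minimal if for every proper subset $X$ of $V(G)$ with $x,y\in X$ and $|X|\geq 3$, $G[X]$ is decomposable. *)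

(* Defs.v *)
From mathcomp Require Import all_boot.

Set Implicit Arguments.
Unset Strict Implicit.
Unset Printing Implicit Defensive.

Record sgraph := SGraph {
  vertex :> finType;
  adj : rel vertex;
  adj_sym : symmetric adj;
  adj_irrefl : irreflexive adj }.

Section Induced.
Variables (G : sgraph) (X : {set G}).

Definition induced_vertex : finType := {x : G | x \in X}.

Definition induced_adj : rel induced_vertex :=
  fun u v => adj (val u) (val v).

Lemma induced_adj_sym : symmetric induced_adj.
Proof. by move=> u v; apply: adj_sym. Qed.

Lemma induced_adj_irrefl : irreflexive induced_adj.
Proof. by move=> u; apply: adj_irrefl. Qed.

Definition induced : sgraph := SGraph induced_adj_sym induced_adj_irrefl.

End Induced.

Definition interval (G : sgraph) (I : {set G}) : bool :=
  [forall v, (v \notin I) ==>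
    ([forall u in I, adj v u] || [forall u in I, ~~ adj v u])].

Definition trivial_set (G : sgraph) (I : {set G}) : bool :=
  [|| I == set0, I == setT | [exists x, I == [set x]]].

Definition indecomposable (G : sgraph) : bool :=
  [forall I : {set G}, interval I ==> trivial_set I].

Definition decomposable (G : sgraph) : bool := ~~ indecomposable G.

Section IndecomposabilityGraph.
Variable G : sgraph.

Definition indec_adj : rel G :=
  fun x y => (x != y) && indecomposable (induced (~: [set x; y])).

Lemma indec_adj_sym : symmetric indec_adj.
Proof. by move=> x y; rewrite /indec_adj eq_sym setUC. Qed.

Lemma indec_adj_irrefl : irreflexive indec_adj.
Proof. by move=> x; rewrite /indec_adj eqxx. Qed.

(* Meaningful for indecomposable [G] only; total here for convenience. *)
Definition indec_graph : sgraph := SGraph indec_adj_sym indec_adj_irrefl.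

End IndecomposabilityGraph.

Definition covered (H : sgraph) (X : {set H}) : Prop :=
  forall x y : H, adj x y -> x \in X \/ y \in X.

(* The standing assumptions under which minimality is defined (distinct
   vertices, indecomposable graph, at least 4 vertices) are conjuncts. *)
Definition minimal (G : sgraph) (x y : G) : Prop :=
  [/\ x != y, indecomposable G, 4 <= #|G| &
      forall X : {set G}, X \proper [set: G] -> x \in X -> y \in X ->
        3 <= #|X| -> decomposable (induced X)].

(* Main.v *)
(**
Let X be a smallest set of at least 3 vertices that contains a and b and induces
an indecomposable graph.  By Ehrenfeucht and Rozenberg, an indecomposable induced
subgraph missing at least two vertices can be extended by two vertices.  If an
even positive number of vertices lay outside X, iterating this would end with a
removable pair disjoint from {a, b}, contrary to the covering hypothesis; the same
holds for any X :|: S.  So if #|~: X| is odd and at least 7, no S outside X with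
1, 3 or 5 elements has X :|: S indecomposable.  Then the graph linking x and y
whenever X + x + y is indecomposable is bipartite on each component, without
isolated vertices, twins or induced P5.  Such a graph has an even number of
vertices, a contradiction.
*)
Require Import Defs.
From mathcomp Require Import all_boot.

Set Implicit Arguments.
Unset Strict Implicit.
Unset Printing Implicit Defensive.

(** * Intervals and indecomposability relative to a vertex subset *)

Section IntervalsIn.
Variable G : sgraph.
Implicit Types (A B I X S : {set G}) (u v w x y z : G).

(** Working with subsets of one ambient graph avoids nested [induced] types. *)
Definition interval_in A I : bool :=
  [forall v in A :\: I, forall x in I, forall y in I, adj v x == adj v y].

Lemma interval_inP A I :
  reflect (forall v x y, v \in A -> v \notin I -> x \in I -> y \in I ->
             adj v x = adj v y)
          (interval_in A I).
Proof.
apply: (iffP forall_inP) => [h v x y vA vI xI yI | h v].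
  have /h/forall_inP/(_ x xI)/forall_inP/(_ y yI)/eqP : v \in A :\: I.
    by rewrite inE vI.
  by [].
rewrite inE => /andP[vI vA]; apply/forall_inP => x xI; apply/forall_inP => y yI.
by apply/eqP/h.
Qed.

Definition indec_on A : bool :=
  [forall I : {set G},
     (I \subset A) ==> interval_in A I ==> (#|I| <= 1) || (I == A)].

Lemma indec_onP A :
  reflect (forall I, I \subset A -> 1 < #|I| -> interval_in A I -> I = A)
          (indec_on A).
Proof.
apply: (iffP forallP) => [h I sIA cI iI | h I].
  by move: (h I); rewrite sIA iI /= leqNgt cI => /eqP.
apply/implyP => sIA; apply/implyP => iI; rewrite leqNgt.
by case: ltnP => //= cI; apply/eqP/h.
Qed.

Lemma interval_inS A B I :
  B \subset A -> interval_in A I -> interval_in B (I :&: B).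
Proof.
move=> /subsetP sBA /interval_inP iI; apply/interval_inP => v x y vB.
rewrite !inE vB andbT => vI /andP[xI _] /andP[yI _].
by apply: iI => //; apply: sBA.
Qed.

(** Two of the three pairs in a 3-set are both edges or both non-edges. They share a vertex, and the
    other two vertices form an interval. This raises the bound 3 on [#|X|] to the 4 that [minimal]
    demands. *)
Lemma indec_on_card_neq3 A : indec_on A -> #|A| != 3.
Proof.
move=> /indec_onP indA; apply/negP => cA.
suff pair x y z : A = [set x; y; z] -> y != z -> x \notin [set y; z] ->
    adj x y = adj x z -> False.
  have /card_gt2P[x [y [z [[xA yA zA] [xy yz zx]]]]] : 2 < #|A| by rewrite (eqP cA).
  have AE : A = [set x; y; z].
    apply/esym/eqP; rewrite eqEcard (eqP cA) -setUA cardsU1 cards2 !inE.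
    rewrite negb_or xy yz eq_sym zx /= andbT.
    by apply/subsetP => t; rewrite !inE => /or3P[]/eqP->.
  have AE2 : A = [set y; x; z] by rewrite AE (setUC [set x]).
  have AE3 : A = [set z; x; y] by rewrite AE setUC setUA.
  have := pair x y z AE yz; rewrite !inE negb_or xy eq_sym zx => /(_ isT).
  have := pair y x z AE2; rewrite !inE negb_or yz (eq_sym x z) zx (eq_sym y x) xy.
  move=> /(_ isT isT).
  have := pair z x y AE3; rewrite !inE negb_or xy zx (eq_sym z y) yz.
  move=> /(_ isT isT); rewrite (adj_sym y x) (adj_sym z x) (adj_sym z y).
  by case: (adj x y) (adj x z) (adj y z) => -[] [] h3 h2 h1;
    first [exact: h1 | exact: h2 | exact: h3].
move=> AE yz xyz exy; have AI : [set y; z] = A.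
  apply: indA.
  - by rewrite AE -setUA subsetUr.
  - by rewrite cards2 yz.
  apply/interval_inP => v p q; rewrite {1}AE -setUA in_setU1 => /orP[/eqP->|->//].
  by move=> _; rewrite !inE => /orP[]/eqP-> /orP[]/eqP->.
by move: xyz; rewrite AI AE !inE eqxx.
Qed.

End IntervalsIn.

(** * Transfer between induced subgraphs and vertex subsets *)

Lemma indecomposableE (G : sgraph) : indecomposable G = indec_on [set: G].
Proof.
apply: eq_forallb => I; rewrite subsetT /=; congr (_ ==> _).
  apply/forallP/interval_inP => [h v x y _ vI xI yI | h v].
    move: (h v); rewrite vI => /orP[]/forall_inP hv; first by rewrite !hv.
    by rewrite (negbTE (hv x xI)) (negbTE (hv y yI)).
  apply/implyP => vI; have [->|[x xI]] := set_0Vmem I.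
    by apply/orP; left; apply/forall_inP => x; rewrite inE.
  case vx: (adj v x); apply/orP; [left | right]; apply/forall_inP => y yI.
    by rewrite (h v y x) // inE.
  by rewrite (h v y x) ?vx // inE.
rewrite /trivial_set orbA orbAC; congr (_ || _).
by rewrite leq_eqVlt ltnS leqn0 cards_eq0 orbC; congr (_ || _); apply/existsP/cards1P => -[x]; [move/eqP | move=> ->]; exists x.
Qed.

(** Stated for subsets of [induced A], so as to serve also for subgraphs of induced subgraphs. *)
Lemma indec_on_val (G : sgraph) (A : {set G}) (B : {set induced A}) :
  indec_on B = indec_on (val @: B).
Proof.
have valI : injective (val : induced A -> G) := val_inj.
have mem (C : {set induced A}) (u : induced A) : (val u \in val @: C) = (u \in C).
  exact: mem_imset.
have intE (I : {set induced A}) : interval_in B I = interval_in (val @: B) (val @: I).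
  apply/interval_inP/interval_inP => h v x y.
    move=> /imsetP[v' vB ->]; rewrite mem => vI /imsetP[x' xI ->] /imsetP[y' yI ->].
    exact: (h v' x' y').
  by move=> vB vI xI yI; apply: (h (val v) (val x) (val y)); rewrite mem.
apply/indec_onP/indec_onP => h I sIB cI iI.
  have IE : I = val @: ((val : induced A -> G) @^-1: I).
    apply/setP => x; apply/idP/imsetP => [xI|[x' + ->]]; last by rewrite inE.
    have /imsetP[x' x'B xE] := subsetP sIB x xI.
    by exists x' => //; rewrite inE -xE.
  rewrite IE; suff -> : (val : induced A -> G) @^-1: I = B by []; apply: h.
  - by apply/subsetP => x; rewrite inE => /(subsetP sIB); rewrite mem.
  - by rewrite -(card_imset _ valI) -IE.
  - by rewrite intE -IE.
apply: (imset_inj valI); apply: h; first exact: imsetS.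
- by rewrite card_imset.
- by rewrite -intE.
Qed.

Lemma imset_val_induced (G : sgraph) (A : {set G}) :
  val @: [set: induced A] = A.
Proof.
apply/setP => x; apply/imsetP/idP => [[[y yA] _ ->] //|xA].
by exists (exist _ x xA).
Qed.

Lemma indecomposable_induced (G : sgraph) (A : {set G}) :
  indecomposable (induced A) = indec_on A.
Proof. by rewrite indecomposableE indec_on_val imset_val_induced. Qed.


(** * Positions of vertices outside an indecomposable set *)

Section Classes.
Variables (G : sgraph) (a0 : G).
Implicit Types (Y Z I B : {set G}) (c : option G) (u v w x y z : G).

(* The possible positions of a vertex z outside Y for which Y + z is
   decomposable: [None] if Y is an interval of Y + z, [Some u] if {u, z} is.
   The adjacency of z to another vertex y prescribed by the position is
   [dflt c z y], where a0 stands for an arbitrary vertex of Y. *)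
Definition dflt c z y : bool := if c is Some u then adj u y else adj z a0.

Definition anchored Y c : bool := if c is Some u then u \in Y else true.

(** The test [Some y != c] exempts [u] itself when [c] is [Some u]: the adjacency between the twins
    [u] and [z] is free. *)
Definition in_class Y c z : bool :=
  anchored Y c &&
  [forall y in Y, (Some y != c) ==> (adj z y == dflt c z y)].

Lemma in_classP Y c z :
  reflect (anchored Y c /\
           forall y, y \in Y -> Some y != c -> adj z y = dflt c z y)
          (in_class Y c z).
Proof.
apply: (iffP andP) => -[cY h]; split => //.
  by move=> y yY yc; apply/eqP; move/forall_inP/(_ y yY)/implyP: h => ->.
by apply/forall_inP => y yY; apply/implyP => yc; rewrite h.
Qed.

Lemma in_class_adj Y c z y :
  in_class Y c z -> y \in Y -> Some y != c -> adj z y = dflt c z y.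
Proof. by case/in_classP => _; apply. Qed.

Lemma in_class_mem Y u z : in_class Y (Some u) z -> u \in Y.
Proof. by case/in_classP. Qed.

Lemma in_class_same Y c y z : a0 \in Y ->
  {in Y, adj z =1 adj y} -> in_class Y c y -> in_class Y c z.
Proof.
move=> a0Y zy /in_classP[cY h]; apply/in_classP; split=> // w wY wc.
by rewrite zy // h //; case: c {cY h wc} => //=; rewrite zy.
Qed.

Lemma in_classS Y Y' c z : Y' \subset Y ->
  anchored Y' c -> in_class Y c z -> in_class Y' c z.
Proof.
move=> /subsetP sYY' cY' /in_classP[_ h]; apply/in_classP; split=> // y /sYY'.
exact: h.
Qed.

Lemma in_class_Some_same Y u z : u \notin Y ->
  in_class (u |: Y) (Some u) z -> {in Y, adj z =1 adj u}.
Proof.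
move=> uY /in_class_adj h y yY; rewrite h ?inE ?yY ?orbT //.
by apply: contra uY => /eqP[<-].
Qed.

Lemma indec_cap Y Z I : Y \subset Z -> indec_on Y -> interval_in Z I ->
  Y \subset I \/ #|I :&: Y| <= 1.
Proof.
move=> sYZ /indec_onP indY iI; case: (leqP #|I :&: Y| 1) => cI; [by right|left].
apply/setIidPr/indY => //; first exact: subsetIr.
exact: interval_inS iI.
Qed.

Lemma cards_le1_cases I : #|I| <= 1 -> I = set0 \/ exists u, I = [set u].
Proof.
rewrite leq_eqVlt ltnS leqn0 => /orP[/cards1P|/eqP/cards0_eq]; by [right|left].
Qed.

(** A nontrivial interval of [z |: Y] meets [Y] in a trivial interval of [Y]. If that is [Y], the
    position is [None]; if it is one vertex [u], the interval is [{u, z}]; if it were empty, only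
    [z] would remain. *)
Lemma not_indec_add_class Y z : a0 \in Y -> indec_on Y -> z \notin Y ->
  ~~ indec_on (z |: Y) -> exists c, in_class Y c z.
Proof.
move=> a0Y indY zY; rewrite negb_forall => /existsP[I].
rewrite !negb_imply negb_or -ltnNge => /and4P[sI iI cI nI].
move/interval_inP: (iI) => hI.
have sY : Y \subset z |: Y by exact: subsetUr.
have [sYI|] := indec_cap sY indY iI.
  have zI : z \notin I.
    by apply: contra nI => zI; rewrite eqEsubset sI subUset sub1set zI.
  exists None; apply/in_classP; split=> // y yY _ /=.
  by apply: hI => //; rewrite ?setU11 ?(subsetP sYI).
move=> /cards_le1_cases cIY.
have IE : I = (I :&: [set z]) :|: (I :&: Y) by rewrite -setIUr; exact/esym/setIidPl.
case: cIY => [I0|[u Iu]].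
  have := subset_leq_card (subsetIr I [set z]); rewrite cards1 leqNgt.
  by rewrite -[I :&: [set z]]setU0 -I0 -IE cI.
have : u \in I :&: Y by rewrite Iu set11.
rewrite inE => /andP[uI uY]; have zI : z \in I.
  apply: contraLR cI => zI; rewrite -leqNgt IE Iu.
  suff -> : I :&: [set z] = set0 by rewrite set0U cards1.
  by apply/eqP; rewrite setI_eq0 disjoint_sym disjoints1.
exists (Some u); apply/in_classP; split=> // y yY yu /=.
have yI : y \notin I.
  apply: contra yu => yI; have : y \in I :&: Y by rewrite inE yI.
  by rewrite Iu inE => /eqP->.
by rewrite adj_sym (adj_sym u); apply: hI => //; rewrite setU1r.
Qed.

(** Positions [Some u] and [Some w] would make [{u, w}] an interval of [Y]; positions [Some u] and
    [None] would make [Y :\ u] one. *)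
Lemma in_class_uniq Y c c' z : indec_on Y -> 3 <= #|Y| ->
  in_class Y c z -> in_class Y c' z -> c = c'.
Proof.
move=> /indec_onP indY cY.
have half u : in_class Y (Some u) z -> ~ in_class Y None z.
  move=> hu /in_class_adj hn.
  have uY := in_class_mem hu.
  have : Y :\ u = Y.
    apply: indY; rewrite ?subD1set //.
      by move: cY; rewrite (cardsD1 u) uY add1n.
    apply/interval_inP => v x y vY; rewrite !inE vY andbT negbK => /eqP->{v vY}.
    move=> /andP[xu xY] /andP[yu yY].
    have := in_class_adj hu xY; rewrite (inj_eq Some_inj) xu => /(_ isT)/= <-.
    have := in_class_adj hu yY; rewrite (inj_eq Some_inj) yu => /(_ isT)/= <-.
    by rewrite !hn.
  by move/setP/(_ u); rewrite !inE eqxx uY.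
case: c c' => [u|] [w|] // hc hc'; [|by case: (half u)|by case: (half w)].
congr Some; apply/eqP; case: eqVneq => // uw.
have : [set u; w] = Y.
  apply: indY; rewrite ?cards2 ?uw //.
    by rewrite subUset !sub1set (in_class_mem hc) (in_class_mem hc').
  have E v : v \in Y -> v \notin [set u; w] -> adj v u = adj v w.
    rewrite !inE negb_or => vY /andP[vu vw]; rewrite !(adj_sym v).
    have /= <- := in_class_adj hc vY (contra_neq (@Some_inj _ _ _) vu).
    by have /= <- := in_class_adj hc' vY (contra_neq (@Some_inj _ _ _) vw).
  apply/interval_inP => v x y vY vI; have vv := E v vY vI.
  by rewrite !inE => /orP[]/eqP-> /orP[]/eqP->.
by move=> YE; move: cY; rewrite -YE cards2 uw.
Qed.

Lemma dflt_sym Y c c' x y : a0 \in Y -> in_class Y c x -> in_class Y c' y ->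
  c != c' -> dflt c x y = dflt c' y x.
Proof.
move=> a0Y hx hy cc'; case: c c' => [u|] [w|] // in hx hy cc' *.
- have uw := cc'; rewrite eq_sym in cc'.
  have /= := in_class_adj hx (in_class_mem hy) cc'.
  have /= := in_class_adj hy (in_class_mem hx) uw.
  by rewrite (adj_sym y) (adj_sym x) => -> ->; rewrite adj_sym.
- by have /= <- := in_class_adj hy (in_class_mem hx) isT; apply: adj_sym.
- by have /= <- := in_class_adj hx (in_class_mem hy) isT; apply: adj_sym.
Qed.

(** An interval of the enlarged set contains [Y], misses it or meets it in one vertex. In each case
    a nontrivial one would give [x] and [y] a common position or the prescribed adjacency. *)
Lemma indec_add2 Y c c' x y : a0 \in Y -> indec_on Y -> 3 <= #|Y| ->
  x \notin Y -> y \notin Y -> in_class Y c x -> in_class Y c' y -> c != c' ->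
  adj x y != dflt c x y -> indec_on (y |: (x |: Y)).
Proof.
move=> a0Y indY cY xY yY hx hy cc' xy.
have uniqc := in_class_uniq indY cY.
pose Z := y |: (x |: Y); rewrite -/Z.
have sYZ : Y \subset Z by apply/subsetP => t; rewrite !inE => ->; rewrite !orbT.
have xZ : x \in Z by rewrite !inE eqxx orbT.
have yZ : y \in Z by rewrite !inE eqxx.
have yx : adj y x != dflt c' y x by rewrite -(dflt_sym a0Y hx hy cc') adj_sym.
(* Here [p] has position [None]; [q] either lies in [I], so that its adjacency to [p] is the
   prescribed one, or has position [None] too. *)
have out I p d q d' : interval_in Z I -> Y \subset I -> p \in Z -> p \notin I ->
    in_class Y d p -> adj p q != dflt d p q -> d != d' -> in_class Y d' q ->
    q \in Z -> False.
  move=> /interval_inP hI sYI pZ pI hp pq dd' hq qZ.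
  have a0I := subsetP sYI _ a0Y.
  have dN : None = d.
    apply: uniqc hp; apply/in_classP; split=> // t tY _ /=.
    by apply: hI => //; apply: (subsetP sYI).
  move: pq; rewrite -dN /= => /negP[]; apply/eqP.
  case qI: (q \in I); first by apply: hI.
  have : d' = d by rewrite -dN; apply: uniqc hq _; apply/in_classP; split=> // t tY _ /=;
    apply: hI; rewrite ?qI // (subsetP sYI).
  by move=> dd; rewrite dd eqxx in dd'.
have one I p d u : interval_in Z I -> I :&: Y = [set u] -> p \in I ->
    in_class Y d p -> Some u = d.
  move=> /interval_inP hI IY pI; apply: uniqc.
  have : u \in I :&: Y by rewrite IY set11.
  rewrite inE => /andP[uI uY].
  apply/in_classP; split=> // t tY tu /=; rewrite adj_sym (adj_sym u).
  apply: hI => //; first exact: (subsetP sYZ).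
  apply: contra tu => tI; have : t \in I :&: Y by rewrite inE tI.
  by rewrite IY inE => /eqP->.
apply/indec_onP => I sIZ cI iI.
have [sYI|/cards_le1_cases] := indec_cap sYZ indY iI.
  apply/eqP; rewrite eqEsubset sIZ /= !subUset !sub1set sYI andbT.
  apply/andP; split; apply/negPn/negP => nI.
    by apply: (out I y c' x c) => //; rewrite eq_sym.
  by apply: (out I x c y c').
move/interval_inP: (iI) => hI.
have sub t : t \in I -> t \notin Y -> (t == x) || (t == y).
  by move=> /(subsetP sIZ); rewrite !inE orbA => /orP[|->//]; rewrite orbC.
case=> [IY|[u Iu]].
  have nY t : t \in I -> t \notin Y.
    by move=> tI; apply/negP => tY; have := in_set0 t; rewrite -IY inE tI tY.
  have [xI yI] : x \in I /\ y \in I.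
    have /card_gt1P[p [q [pI qI pq]]] := cI.
    case/orP: (sub p pI (nY p pI)) (sub q qI (nY q qI)) => /eqP pE /orP[]/eqP qE;
      move: pI qI pq; rewrite pE qE ?eqxx //; by split.
  have := uniqc c c' y; rewrite hy => h; rewrite h ?eqxx // in cc'.
  apply: in_class_same hx => // t tY; rewrite adj_sym (adj_sym x).
  apply: hI => //; first exact: (subsetP sYZ).
  by apply/negP => /nY; rewrite tY.
have : u \in I :&: Y by rewrite Iu set11.
rewrite inE => /andP[uI uY].
have [xI|xI] := boolP (x \in I).
  have uc := one I x c u iI Iu xI hx.
  have yI : y \notin I by apply: contra cc' => yI; rewrite -uc (one I y c' u).
  move: xy; rewrite -uc /= => /negP[]; apply/eqP; rewrite adj_sym (adj_sym u).
  exact: hI.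
have [yI|yI] := boolP (y \in I).
  have uc := one I y c' u iI Iu yI hy.
  move: yx; rewrite -uc /= => /negP[]; apply/eqP; rewrite adj_sym (adj_sym u).
  exact: hI.
have : I \subset I :&: Y.
  apply/subsetP => t tI; rewrite inE tI; apply/negPn/negP => /(sub t tI).
  by case/orP => /eqP tE; [rewrite -tE tI in xI | rewrite -tE tI in yI].
by move/subset_leq_card; rewrite Iu cards1 leqNgt cI.
Qed.

(** The interval of [G] that yields the contradiction is [u |: B] for [c = Some u] and [~: B] for
    [c = None]; [b] and two vertices of [Y] make it nontrivial. *)
Lemma class_block Y c B b : a0 \in Y -> indec_on [set: G] -> 2 <= #|Y| ->
  b \in B -> [disjoint B & Y] -> anchored Y c ->
  (forall x z, x \in B -> z \notin B -> Some z != c -> adj x z = dflt c x z) ->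
  False.
Proof.
move=> a0Y /indec_onP indG cY bB BY; have notB y : y \in Y -> y \notin B.
  by move=> yY; apply: contraL yY => yB; rewrite (disjointFr BY).
case: c => [u|] cY' h.
  have uB := notB u cY'.
  have : u |: B = setT.
    apply: indG; rewrite ?subsetT //.
      by rewrite cardsU1 uB (cardsD1 b) bB.
    have E v x : v \notin u |: B -> x \in u |: B -> adj v x = adj v u.
      rewrite !inE negb_or => /andP[vu vB] /orP[/eqP->//|xB].
      by rewrite adj_sym (h x v xB vB) /= 1?adj_sym // (contra_neq (@Some_inj _ _ _) vu).
    by apply/interval_inP => v x y _ vI xI yI; rewrite !E.
  move/setP => BT; have /card_gt1P[p [q [pY qY pq]]] := cY.
  have := BT p; have := BT q; rewrite !inE (negbTE (notB _ pY)) (negbTE (notB _ qY)).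
  by rewrite !orbF => /eqP qu /eqP pu; rewrite pu qu eqxx in pq.
have : ~: B = setT.
  apply: indG; rewrite ?subsetT //.
    apply: leq_trans cY (subset_leq_card _); apply/subsetP => y /notB.
    by rewrite inE.
  by apply/interval_inP => v x y _; rewrite !inE negbK => vB xB yB; rewrite !h.
by move/setP/(_ b); rewrite !inE bB.
Qed.

(** The Ehrenfeucht-Rozenberg theorem. If no pair could be added, a whole class or the set of all
    outside vertices would yield a nontrivial interval of [G]. *)
Lemma indec_extend2 Y : a0 \in Y -> indec_on [set: G] -> indec_on Y -> 3 <= #|Y| ->
  1 < #|~: Y| ->
  exists x y, [/\ x != y, x \notin Y, y \notin Y & indec_on (y |: (x |: Y))].
Proof.
move=> a0Y indG indY cY cD.
have uniqc := in_class_uniq indY cY.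
case: (boolP [exists x, exists y,
  [&& x != y, x \notin Y, y \notin Y & indec_on (y |: (x |: Y))]]).
  by case/existsP => x /existsP[y /and4P[]]; exists x, y.
rewrite negb_exists => /forallP noxy; exfalso.
have no x y : x != y -> x \notin Y -> y \notin Y -> ~~ indec_on (y |: (x |: Y)).
  move=> xy xY yY; move: (noxy x); rewrite negb_exists => /forallP/(_ y).
  by rewrite xy xY yY.
have indE x : x \notin Y -> indec_on (x |: Y) \/ exists c, in_class Y c x.
  move=> xY; case: (boolP (indec_on (x |: Y))); [by left|right].
  exact: not_indec_add_class.
(* The position of [y] over [x |: Y] is either [Some x] or anchored in [Y]; in the latter case it
   also governs the adjacency to [x]. *)
have ext x y : x != y -> x \notin Y -> y \notin Y -> indec_on (x |: Y) ->
    {in Y, adj y =1 adj x} \/ exists2 c, in_class Y c y & adj y x = dflt c y x.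
  move=> xy xY yY indx.
  have yxY : y \notin x |: Y by rewrite !inE negb_or eq_sym xy.
  have [] := not_indec_add_class _ indx yxY (no x y xy xY yY); first by rewrite setU1r.
  move=> c hc; have [cx|cx] := eqVneq c (Some x).
    by left; apply: in_class_Some_same; rewrite -?cx.
  right; exists c.
    apply: in_classS (hc); first exact: subsetUr.
    case: c hc cx => // u /in_class_mem; rewrite !inE => /orP[/eqP->|//].
    by rewrite eqxx.
  by apply: (in_class_adj hc); rewrite ?setU11 // eq_sym.
have [x0 x0Y] : exists x, x \in ~: Y by apply/card_gt0P/ltnW.
have allext x : x \notin Y -> indec_on (x |: Y) /\ forall c, ~ in_class Y c x.
  move=> xY; suff nc c : ~ in_class Y c x.
    by split=> //; case: (indE x xY) => // -[c /nc].
  (* [B] is the full class [c]. Its members obey [c] towards a vertex that extends [Y] by [ext], and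
     towards one of another class by [indec_add2]. *)
  move=> hc; pose B := [set t | (t \notin Y) && in_class Y c t].
  apply: (@class_block Y c B x) => //.
  - exact: ltnW.
  - by rewrite inE xY.
  - by rewrite disjoint_subset; apply/subsetP => t; rewrite !inE => /andP[].
  - by case/in_classP: hc.
  move=> p z; rewrite !inE negb_and negbK => /andP[pY hp] zB zc.
  have [zY|zY] := boolP (z \in Y); first exact: in_class_adj hp zY zc.
  have pz : p != z by apply: contraTneq zB => <-; rewrite negb_or pY hp.
  rewrite (negbTE zY) /= in zB.
  have [extz|[c' hc']] := indE z zY.
    have zp : z != p by rewrite eq_sym.
    have [hs|[d hd E]] := ext z p zp zY pY extz.
      by case/negP: zB; apply: in_class_same hp => // t tY; rewrite hs.
    by rewrite E (uniqc c d p hp hd).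
  have cc' : c != c' by apply: contraNneq zB => ->.
  apply/eqP/negPn/negP => npz; move: (no p z pz pY zY) => /negP[].
  exact: (@indec_add2 Y c c').
have /indec_onP hG := indG.
(* By [ext], any two vertices outside [Y] are now twins over [Y], so [~: Y] is an interval of
   [G]. *)
have : ~: Y = setT.
  apply: hG; rewrite ?subsetT //; apply/interval_inP => v x y _.
  rewrite !inE negbK => vY xY yY; have [->//|xy] := eqVneq x y.
  have [extx _] := allext x xY; have [_ ny] := allext y yY.
  have [|[d hd _]] := ext x y xy xY yY extx; last by case: (ny d).
  by move=> /(_ v vY); rewrite !(adj_sym v) => ->.
by move/setP/(_ a0); rewrite !inE a0Y.
Qed.

End Classes.

(** * A parity criterion for bipartite graphs *)

Lemma involution_even_card (T : finType) (f : T -> T) (D : {set T}) :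
  (forall x, x \in D -> [/\ f x \in D, f (f x) = x & f x != x]) -> ~~ odd #|D|.
Proof.
elim: {D}_.+1 {-2}D (ltnSn #|D|) => // n IH D cD hf.
have [->|[x xD]] := set_0Vmem D; first by rewrite cards0.
have [fD ffx fx] := hf x xD.
have fD' : f x \in D :\ x by rewrite !inE fx.
rewrite (cardsD1 x) xD (cardsD1 (f x)) fD' /= negbK.
apply: IH => [|y].
  by move: cD; rewrite (cardsD1 x) xD (cardsD1 (f x)) fD' => /ltnW.
rewrite !inE => /and3P[yfx yx yD]; have [fyD ffy fy] := hf y yD; split=> //.
rewrite fyD andbT; apply/andP; split.
  by apply: contraNneq yx => e; rewrite -ffy e ffx.
by apply: contraNneq yfx => e; rewrite -ffy e.
Qed.

(* A twin-free bipartite graph without induced P5 is a union of half graphs;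
   matching each vertex with its neighbor of least neighborhood is then an
   involution. *)
Lemma half_graph_even_card (T : finType) (D : {set T}) (e : rel T) :
  symmetric e -> (forall x y, e x y -> x \in D) ->
  (forall x, x \in D -> exists y, e x y) ->
  (forall x y, x \in D -> y \in D -> e x =1 e y -> x = y) ->
  (forall x y z, e x y -> e y z -> ~~ e x z) ->
  (forall x1 x2 x3 x4 x5, e x1 x2 -> e x2 x3 -> e x3 x4 -> e x4 x5 ->
     ~~ e x1 x4 -> ~~ e x2 x5 -> False) ->
  ~~ odd #|D|.
Proof.
move=> es eD iso twin tri p5; pose N x := [set y | e x y].
have ND x y : y \in N x -> y \in D by rewrite inE es; apply: eD.
(* Private neighbors [z] of [y] and [z'] of [y'] would give the path [z], [y], [x], [y'], [z']
   forbidden by [p5]. *)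
have chain x y y' : y \in N x -> y' \in N x -> (N y \subset N y') || (N y' \subset N y).
  rewrite !inE => xy xy'; case: (boolP (N y \subset N y')) => //= /subsetPn[z].
  rewrite !inE => yz y'z; apply/subsetP => z'; rewrite !inE => y'z'.
  apply/negPn/negP => yz'; apply: (p5 z y x y' z') => //; by rewrite es // es.
have least x : x \in D -> exists y, (y \in N x) && [forall y' in N x, N y \subset N y'].
  move=> xD; have [y0 xy0] := iso x xD; have y0N : y0 \in N x by rewrite inE.
  have [y yN hy] := arg_minnP (fun y => #|N y|) y0N.
  exists y; rewrite [y \in _]yN; apply/forall_inP => y' y'N.
  case/orP: (chain x y y' yN y'N) => // s.
  by have /eqP-> : N y' == N y by rewrite eqEcard s hy.
have {}twin x y : x \in D -> y \in D -> N x = N y -> x = y.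
  by move=> xD yD /setP h; apply: twin => // z; have := h z; rewrite !inE.
pose m x := odflt x [pick y | (y \in N x) && [forall y' in N x, N y \subset N y']].
have mP x : x \in D -> m x \in N x /\ forall y, y \in N x -> N (m x) \subset N y.
  move=> /least[y hy]; rewrite /m; case: pickP => [z /andP[zN /forall_inP]|/(_ y)].
    by [].
  by rewrite hy.
apply: (@involution_even_card _ m) => x xD; have [mN mle] := mP x xD.
have mD := ND _ _ mN; have xm : x \in N (m x) by move: mN; rewrite !inE es.
split=> //; last first.
  apply: contraTneq mN => ->; rewrite inE; apply/negP => exx.
  by have := tri x x x exx exx; rewrite exx.
(* As [x] is a neighbor of [m x], [N (m (m x))] lies in [N x]. Conversely, each [y] in [N x] has
   [N (m x)] inside [N y], so it is adjacent to [m (m x)]. *)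
have [mmN mmle] := mP _ mD; apply: twin => //; first exact: ND mmN.
apply/eqP; rewrite eqEsubset mmle //=; apply/subsetP => y yN.
have := subsetP (mle y yN) _ mmN; by rewrite !inE es.
Qed.

(** * The link graph on the vertices outside [X] *)

Section OutsideGraph.
Variables (G : sgraph) (a0 : G) (X : {set G}).
Implicit Types (u v w x y z p q : G).

Definition class_of z : option G := odflt None [pick c | in_class a0 X c z].

(** The criterion of [indec_add2] with [X] for [Y]: linked vertices can be added together. *)
Definition link x y : bool :=
  [&& x \notin X, y \notin X, class_of x != class_of y &
      adj x y != dflt a0 (class_of x) x y].

Hypotheses (a0X : a0 \in X) (indG : indec_on [set: G]) (indX : indec_on X).
Hypothesis cardX : 3 <= #|X|.
Hypothesis no_odd_ext : forall S : {set G},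
  [disjoint S & X] -> #|S| \in [:: 1; 3; 5] -> ~~ indec_on (S :|: X).

Local Notation cls := (in_class a0).

Lemma no_ext1 x : x \notin X -> ~~ indec_on (x |: X).
Proof. by move=> xX; apply: no_odd_ext; rewrite ?disjoints1 ?cards1. Qed.

Lemma no_ext3 x y z : uniq [:: x; y; z] -> all [predC X] [:: x; y; z] ->
  ~~ indec_on (z |: (y |: (x |: X))).
Proof.
move=> u /allP aX; have -> : z |: (y |: (x |: X)) = [set t in [:: x; y; z]] :|: X.
  by apply/setP => t; rewrite !inE; do !case: eqP.
apply: no_odd_ext.
  by rewrite disjoint_subset; apply/subsetP => t; rewrite inE => /aX.
by rewrite cardsE (card_uniqP u).
Qed.

Lemma no_ext5 x y z v w : uniq [:: x; y; z; v; w] ->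
  all [predC X] [:: x; y; z; v; w] ->
  ~~ indec_on (w |: (v |: (z |: (y |: (x |: X))))).
Proof.
move=> u /allP aX.
have -> : w |: (v |: (z |: (y |: (x |: X)))) = [set t in [:: x; y; z; v; w]] :|: X.
  by apply/setP => t; rewrite !inE; do !case: eqP.
apply: no_odd_ext.
  by rewrite disjoint_subset; apply/subsetP => t; rewrite inE => /aX.
by rewrite cardsE (card_uniqP u).
Qed.

Lemma class_ofP z : z \notin X -> cls X (class_of z) z.
Proof.
move=> zX; have [c hc] := not_indec_add_class a0X indX zX (no_ext1 zX).
by rewrite /class_of; case: pickP => [//|/(_ c)]; rewrite hc.
Qed.

Lemma class_of_eq c z : z \notin X -> cls X c z -> class_of z = c.
Proof. by move=> zX; apply: in_class_uniq => //; apply: class_ofP. Qed.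

Lemma class_of_neq x y : y \notin X -> class_of x != Some y.
Proof.
move=> yX; rewrite /class_of; case: pickP => //= c hc.
by apply: contraNneq yX => cy; rewrite cy in hc; apply: in_class_mem hc.
Qed.

Lemma link_sym : symmetric link.
Proof.
suff h x y : link x y -> link y x by move=> x y; apply/idP/idP; apply: h.
case/and4P => xX yX xy lxy; apply/and4P; split; rewrite // 1?eq_sym //.
by rewrite -(dflt_sym a0X (class_ofP xX) (class_ofP yX) xy) adj_sym eq_sym.
Qed.

Lemma link_neq x y : link x y -> x != y.
Proof. by case/and4P => _ _ cxy _; apply: contraNneq cxy => ->. Qed.

Lemma link_indec x y : link x y -> indec_on (y |: (x |: X)).
Proof.
by case/and4P => xX yX cxy lxy; apply: (indec_add2 a0X) (class_ofP xX) (class_ofP yX) _ _.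
Qed.

Lemma not_link_adj x y : x \notin X -> y \notin X -> class_of x != class_of y ->
  ~~ link x y -> adj x y = dflt a0 (class_of x) x y.
Proof. by rewrite /link => -> -> -> /= /negbNE/eqP. Qed.

Lemma same_class_of x y : x \notin X -> y \notin X -> {in X, adj x =1 adj y} ->
  class_of x = class_of y.
Proof.
by move=> xX yX xy; apply: class_of_eq => //; apply: in_class_same xy (class_ofP yX).
Qed.

Lemma same_dflt_l c x y z : {in X, adj x =1 adj y} -> dflt a0 c x z = dflt a0 c y z.
Proof. by move=> xy; case: c => //=; rewrite xy. Qed.

Lemma same_dflt_r c x y z : {in X, adj x =1 adj y} -> anchored X c ->
  dflt a0 c z x = dflt a0 c z y.
Proof. by move=> xy; case: c => //= u uX; rewrite !(adj_sym u) xy. Qed.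

Lemma anchored_class_of z : z \notin X -> anchored X (class_of z).
Proof. by move/class_ofP/in_classP => []. Qed.

Lemma setU2_class c x y z : cls (y |: (x |: X)) c z ->
  [\/ c = Some y, c = Some x | anchored X c].
Proof.
case: c => [u /in_class_mem|]; last by constructor 3.
by rewrite !inE => /or3P[/eqP->|/eqP->|]; [constructor 1 | constructor 2 | constructor 3].
Qed.

(** By [no_ext3], [z] has a position over [y |: (x |: X)]. [Some y] would give [y] and [z] the same
    class, and a position anchored in [X] would prescribe the adjacency of [z] to [y]; both
    contradict [link y z]. *)
Lemma link2_class x y z : link x y -> link y z -> x != z ->
  cls (y |: (x |: X)) (Some x) z.
Proof.
move=> xy yz xz; have /and4P[xX yX cxy _] := xy; have /and4P[_ zX cyz lyz] := yz.
have zY : z \notin y |: (x |: X).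
  by rewrite !inE !negb_or eq_sym (link_neq yz) eq_sym xz.
have nY : ~~ indec_on (z |: (y |: (x |: X))).
  by apply: no_ext3; rewrite /= ?inE ?negb_or ?xX ?yX ?zX // (link_neq xy) xz (link_neq yz).
have a0Y : a0 \in y |: (x |: X) by rewrite !inE a0X !orbT.
have sXY : X \subset y |: (x |: X) by apply/subsetP => t; rewrite !inE => ->; rewrite !orbT.
have [c hc] := not_indec_add_class a0Y (link_indec xy) zY nY.
case: (setU2_class hc) => [cE|<- //|aX].
  case/negP: cyz; apply/eqP/esym/same_class_of => // t tX; rewrite cE in hc.
  apply: (in_class_adj hc); first exact: (subsetP sXY).
  by apply: contraNneq yX => -[<-].
have cE := class_of_eq zX (in_classS sXY aX hc).
move: yz; rewrite link_sym => /and4P[_ _ _ /negP[]]; apply/eqP; rewrite cE.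
by apply: (in_class_adj hc); rewrite ?setU11 // -cE eq_sym class_of_neq.
Qed.

(** This makes components bipartite: vertices two links apart share their class, linked ones never
    do. *)
Lemma link2_same x y z : link x y -> link y z -> {in X, adj z =1 adj x}.
Proof.
move=> xy yz t tX; have [->//|xz] := eqVneq x z.
apply: (in_class_adj (link2_class xy yz xz)); first by rewrite !inE tX !orbT.
by have /and4P[xX _ _ _] := xy; apply: contraNneq xX => -[<-].
Qed.

(* In particular the value of [adj z v] is then dictated by X. *)
Lemma not_link_class v p z : link v p -> class_of z = class_of v -> z \notin X ->
  z != v -> ~~ link z p -> cls (p |: (v |: X)) (class_of z) z.
Proof.
move=> vp czv zX zv nzp; have /and4P[vX pX cvp lvp] := vp.
have zp : z != p by apply: contraNneq cvp => <-; rewrite czv.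
have zY : z \notin p |: (v |: X) by rewrite !inE !negb_or zp zv.
have nY : ~~ indec_on (z |: (p |: (v |: X))).
  apply: no_ext3; rewrite /= ?inE ?negb_or ?vX ?pX ?zX //.
  by rewrite (link_neq vp) eq_sym zv eq_sym zp.
have a0Y : a0 \in p |: (v |: X) by rewrite !inE a0X !orbT.
have sXY : X \subset p |: (v |: X) by apply/subsetP => t; rewrite !inE => ->; rewrite !orbT.
have [c hc] := not_indec_add_class a0Y (link_indec vp) zY nY.
have same u : u \notin X -> c = Some u -> {in X, adj z =1 adj u}.
  move=> uX cE t tX; rewrite cE in hc; apply: (in_class_adj hc).
    exact: (subsetP sXY).
  by apply: contraNneq uX => -[<-].
(* A twin of [p] over [X] would share the class of [p]; a twin of [v] over [p |: X] would be linked
   to [p], as [v] is. *)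
case: (setU2_class hc) => [cE|cE|aX].
- by case/negP: cvp; rewrite -czv; apply/eqP/same_class_of => //; apply: same.
- case/negP: nzp; rewrite /link zX pX czv cvp (same_dflt_l _ _ (same v vX cE)) /=.
  rewrite (in_class_adj hc) ?setU11 // cE //=.
  by apply: contraNneq cvp => -[->].
by rewrite (class_of_eq zX (in_classS sXY aX hc)).
Qed.

Lemma not_link_adj_same_class v p z : link v p -> class_of z = class_of v ->
  z \notin X -> z != v -> ~~ link z p -> adj z v = dflt a0 (class_of z) z v.
Proof.
move=> vp czv zX zv nzp; have /and4P[vX _ _ _] := vp.
apply: (in_class_adj (not_link_class vp czv zX zv nzp)); first by rewrite !inE eqxx orbT.
by rewrite eq_sym class_of_neq.
Qed.

(** The isolated vertices of one class would satisfy [class_block]; towards non-isolated vertices of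
    the class this is [not_link_adj_same_class]. *)
Lemma link_not_isolated v : v \notin X -> exists y, link v y.
Proof.
move=> vX; case: (boolP [exists y, link v y]) => [/existsP //|nv]; exfalso.
pose B := [set x | [&& x \notin X, class_of x == class_of v & ~~ [exists y, link x y]]].
apply: (@class_block G a0 X (class_of v) B v) => //.
- exact: ltnW.
- by rewrite inE vX eqxx.
- by rewrite disjoint_subset; apply/subsetP => t; rewrite !inE => /andP[].
- exact: anchored_class_of.
move=> x z; rewrite inE => /and3P[xX /eqP cx nx] zB zc; rewrite -cx; rewrite -cx in zc.
have [zX|zX] := boolP (z \in X); first exact: in_class_adj (class_ofP xX) zX zc.
have nl y : ~~ link x y by apply: contra nx => h; apply/existsP; exists y.
have [czx|czx] := eqVneq (class_of z) (class_of x); last first.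
  by apply: not_link_adj; rewrite // eq_sym.
move: zB; rewrite inE zX czx cx eqxx /= negbK => /existsP[p zp].
rewrite -cx; apply: (not_link_adj_same_class zp) => //.
by apply: contraTneq zp => <-.
Qed.

(** The vertices with the same links as [v] form an interval of [G] disjoint from [X]. *)
Lemma link_twin_free v w : v \notin X -> w \notin X -> link v =1 link w -> v = w.
Proof.
move=> vX wX hvw; have [//|vw] := eqVneq v w; exfalso.
have [p vp] := link_not_isolated vX.
pose T := [set x | (x \notin X) && [forall q, link x q == link v q]].
have TP x : x \in T -> x \notin X /\ link x =1 link v.
  by rewrite inE => /andP[xX /forallP h]; split=> // q; apply/eqP.
have vT : v \in T by rewrite inE vX; apply/forallP.
have wT : w \in T by rewrite inE wX; apply/forallP => q; rewrite hvw.
suff h z x : z \notin T -> x \in T -> adj z x = adj z v.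
  have /indec_onP hG := indG; suff /setP/(_ a0) : T = setT by rewrite !inE a0X.
  apply: hG; rewrite ?subsetT //; first by apply/card_gt1P; exists v, w.
  by apply/interval_inP => z x y _ zT xT yT; rewrite !h.
move=> zT /TP[xX lx]; have svx : {in X, adj x =1 adj v}.
  by apply: (@link2_same _ p); rewrite // link_sym lx.
have cxv := same_class_of xX vX svx.
have [zX|zX] := boolP (z \in X); first by rewrite !(adj_sym z) svx.
have zr : dflt a0 (class_of z) z x = dflt a0 (class_of z) z v.
  by apply: same_dflt_r => //; apply: anchored_class_of.
have [czv|czv] := eqVneq (class_of z) (class_of v); last first.
  have := lx z; rewrite !(link_sym _ z) /link zX xX vX cxv czv /= zr.
  by move=> /negb_inj; case: (adj z x) (adj z v) (dflt _ _ _ _) => [] [] [].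
have zv : z != v by apply: contraNneq zT => ->.
have zx : z != x by apply: contraNneq zT => ->; rewrite inE xX; apply/forallP => q; rewrite lx.
(* Now [z], [v] and [x] share a class, and a vertex [q] that tells the links of [z] from those of
   [v] fixes the adjacency of [z] to [v] and [x]. *)
move: zT; rewrite inE zX /= negb_forall => /existsP[q].
have [vq|nvq] := boolP (link v q) => lq.
  have nzq : ~~ link z q by apply: contra lq => ->.
  have xq : link x q by rewrite lx.
  rewrite (not_link_adj_same_class vq) // (not_link_adj_same_class xq) //.
  by rewrite cxv.
have zq : link z q by case: (link z q) lq.
have nxq : ~~ link x q by rewrite lx.
rewrite !(adj_sym z) (not_link_adj_same_class zq _ vX) // 1?eq_sym //.
rewrite (not_link_adj_same_class zq _ xX) // ?cxv // 1?eq_sym //.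
exact: same_dflt_l.
Qed.

(** [X] with [x2], [x3], [x4], [x5] is indecomposable, and by [no_ext5] [x1] has a position over it.
    This can only be [Some x3], which would link [x1] to [x4], as [x3] is. *)
Lemma link_no_P5 x1 x2 x3 x4 x5 : link x1 x2 -> link x2 x3 -> link x3 x4 ->
  link x4 x5 -> ~~ link x1 x4 -> ~~ link x2 x5 -> False.
Proof.
move=> l12 l23 l34 l45 n14 n25.
have l21 : link x2 x1 by rewrite link_sym.
have l32 : link x3 x2 by rewrite link_sym.
have l43 : link x4 x3 by rewrite link_sym.
have l54 : link x5 x4 by rewrite link_sym.
have /and4P[x1X x2X _ a12] := l12; have /and4P[_ x3X c23 _] := l23.
have /and4P[x5X x4X _ a54] := l54.
have s13 := link2_same l32 l21; have s24 := link2_same l43 l32.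
have s35 := link2_same l54 l43.
have c13 := same_class_of x1X x3X s13; have c24 := same_class_of x2X x4X s24.
have c35 := same_class_of x3X x5X s35.
have d13 : x1 != x3 by apply: contraNneq n14 => ->.
have d24 : x2 != x4 by apply: contraNneq n25 => ->.
have d15 : x1 != x5 by apply: contraNneq n14 => ->.
have d53 : x5 != x3 by apply: contraNneq n25 => ->.
have d25 : x2 != x5 by apply: contraNneq c23 => ->; rewrite c35.
have d14 : x1 != x4 by apply: contraNneq c23 => e; rewrite c24 -e c13.
pose Y := x2 |: (x3 |: X).
have indY : indec_on Y := link_indec l32.
have sXY : X \subset Y by apply/subsetP => t; rewrite !inE => ->; rewrite !orbT.
have a0Y : a0 \in Y := subsetP sXY _ a0X.
have cardY : 3 <= #|Y| := leq_trans cardX (subset_leq_card sXY).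
have uniqY := in_class_uniq indY cardY.
have x1Y : x1 \notin Y by rewrite !inE !negb_or (link_neq l12) d13.
have x4Y : x4 \notin Y by rewrite !inE !negb_or (link_neq l43) eq_sym d24.
have x5Y : x5 \notin Y by rewrite !inE !negb_or eq_sym d25 d53.
have h1 : cls Y (Some x3) x1 by apply: link2_class; rewrite // eq_sym.
have h4 : cls Y (Some x2) x4 by rewrite /Y setUCA; apply: link2_class.
have h5 : cls Y (class_of x5) x5.
  by apply: not_link_class; rewrite // link_sym.
pose Y' := x5 |: (x4 |: Y).
have indY' : indec_on Y'.
  apply: (indec_add2 a0Y indY cardY x4Y x5Y h4 h5).
    by rewrite eq_sym class_of_neq.
  (* The position of [x4] prescribes [adj x2 x5]. As [x2] and [x5] are not linked, the class of [x5]
     prescribes the same value, which the link between [x4] and [x5] violates. *)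
  rewrite /= adj_sym (adj_sym x2) [X in _ != X](_ : _ = dflt a0 (class_of x5) x5 x2).
    by rewrite (same_dflt_r _ s24) ?anchored_class_of.
  by apply: not_link_adj; rewrite // 1?link_sym // -c35 eq_sym.
have sYY' : Y \subset Y' by apply/subsetP => t tY; rewrite !inE in tY *; rewrite tY !orbT.
have a0Y' : a0 \in Y' := subsetP sYY' _ a0Y.
have x1Y' : x1 \notin Y' by rewrite 2!in_setU1 !negb_or d15 d14.
have nY' : ~~ indec_on (x1 |: Y').
  apply: no_ext5; rewrite /= ?inE ?negb_or ?x1X ?x2X ?x3X ?x4X ?x5X //.
  rewrite (link_neq l32) (link_neq l34) (eq_sym x3) d53 (eq_sym x3) d13.
  rewrite d24 d25 (link_neq l21) (link_neq l45) (eq_sym x4) d14 (eq_sym x5) d15.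
  by [].
have [c hc] := not_indec_add_class a0Y' indY' x1Y' nY'.
have same u : u \notin Y -> c = Some u -> {in Y, adj x1 =1 adj u}.
  move=> uY cE t tY; rewrite cE in hc; apply: (in_class_adj hc).
    exact: (subsetP sYY').
  by apply: contraNneq uY => -[<-].
have : [\/ c = Some x5, c = Some x4 | anchored Y c].
  case: (c) hc => [u /in_class_mem|]; last by constructor 3.
  by rewrite 2!in_setU1 => /or3P[/eqP->|/eqP->|]; [constructor 1 | constructor 2 | constructor 3].
case=> [cE|cE|aY].
- have := uniqY _ _ _ _ (in_class_same a0Y (same x5 x5Y cE) h5) h1.
  by apply/eqP; rewrite class_of_neq.
- have [] := uniqY _ _ _ _ (in_class_same a0Y (same x4 x4Y cE) h4) h1.
  by apply/eqP; rewrite (link_neq l23).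
have cE := uniqY _ _ _ _ (in_classS sYY' aY hc) h1; rewrite cE in hc.
case/negP: n14; have /and4P[_ _ c34 a34] := l34.
rewrite /link x1X x4X c13 c34 (same_dflt_l _ _ s13).
by rewrite (in_class_adj hc) //= ?inE ?eqxx ?orbT // inj_eq //; [rewrite eq_sym (link_neq l34) | exact: Some_inj].
Qed.

Lemma even_card_outside : ~~ odd #|~: X|.
Proof.
apply: (@half_graph_even_card _ _ link) link_no_P5.
- exact: link_sym.
- by move=> x y /and4P[]; rewrite inE.
- by move=> x; rewrite inE => /link_not_isolated.
- by move=> x y; rewrite !inE; apply: link_twin_free.
move=> x y z xy yz; have /and4P[xX _ _ _] := xy; have /and4P[_ zX _ _] := yz.
by rewrite /link (same_class_of zX xX (link2_same xy yz)) eqxx /= !andbF.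
Qed.

End OutsideGraph.

(** * Removable pairs and the conclusion *)

(** Adding two vertices at a time keeps the complement even, so the process ends at all of [G]; the
    last pair added is the removable one. *)
Lemma even_outside_removable_pair (G : sgraph) (X : {set G}) :
  indecomposable G -> indec_on X -> 3 <= #|X| -> ~~ odd #|~: X| -> 0 < #|~: X| ->
  exists x y, [/\ x != y, x \notin X, y \notin X & indec_on (~: [set x; y])].
Proof.
rewrite indecomposableE => indG.
elim: {X}_.+1 {-2}X (ltnSn #|~: X|) => // n IH X cn indX cX evX posX.
have [a0 a0X] : exists a0, a0 \in X by apply/card_gt0P/(leq_trans _ cX).
have c1 : 1 < #|~: X| by case: #|~: X| evX posX => [|[]].
have [x [y [xy xX yX indY]]] := indec_extend2 a0X indG indX cX c1.
pose Y := y |: (x |: X).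
have cXY : #|~: X| = #|~: Y|.+2.
  rewrite (cardsD1 x) inE xX (cardsD1 y) !inE eq_sym xy yX /= add1n add1n.
  by congr _.+2; apply: eq_card => t; rewrite !inE !negb_or.
have sXY : X \subset Y by apply/subsetP => t; rewrite !inE => ->; rewrite !orbT.
have [Y0|posY] := posnP #|~: Y|.
  exists x, y; split=> //; suff <- : X = ~: [set x; y] by [].
  apply/setP => t; move/cards0_eq/setP/(_ t): Y0; rewrite !inE.
  move/negbFE; case: (boolP (t \in X)) => [tX _|_].
    by apply/esym/norP; split; apply: contraTneq tX => ->.
  by rewrite orbF orbC => ->.
have [|||x' [y' [xy' x'Y y'Y ind']]] := IH Y _ indY _ _ posY.
- by move: cn; rewrite cXY ltnS => /ltnW.
- exact: leq_trans cX (subset_leq_card sXY).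
- by move: evX; rewrite cXY /= negbK.
by exists x', y'; split=> //; [apply: contra x'Y | apply: contra y'Y]; apply: (subsetP sXY).
Qed.

Theorem proposition1p6 (G : sgraph) (a b : G) :
  indecomposable G -> 6 <= #|G| -> a != b ->
  covered (H := indec_graph G) [set a; b] ->
  exists (X : {set G}) (aX : a \in X) (bX : b \in X),
    #|X| \in [:: #|G|; #|G| - 1; #|G| - 3; #|G| - 5] /\
    minimal (G := induced X) (exist _ a aX) (exist _ b bX).
Proof.
move=> indG cG ab cov.
have indT : indec_on [set: G] by rewrite -indecomposableE.
have noeven (X : {set G}) : a \in X -> b \in X -> indec_on X -> 3 <= #|X| ->
    0 < #|~: X| -> odd #|~: X|.
  move=> aX bX indX cX posX; apply/negPn/negP => ev.
  have [x [y [xy xX yX ind]]] := even_outside_removable_pair indG indX cX ev posX.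
  have [] := cov x y; first by rewrite /= /indec_adj xy indecomposable_induced.
  - by rewrite !inE => /orP[]/eqP e; rewrite e ?aX ?bX in xX.
  - by rewrite !inE => /orP[]/eqP e; rewrite e ?aX ?bX in yX.
pose P (X : {set G}) := [&& a \in X, b \in X, 3 <= #|X| & indec_on X].
have PT : P setT by rewrite /P !in_setT indT cardsT (leq_trans _ cG).
have [X /and4P[aX bX cX indX] minX] := arg_minnP (fun X : {set G} => #|X|) PT.
exists X, aX, bX; split.
  have cC := cardsC X.
  suff : #|~: X| \in [:: 0; 1; 3; 5].
    have -> : #|X| = #|G| - #|~: X| by rewrite -cC addnK.
    by rewrite !inE => /or4P[]/eqP->; rewrite ?subn0 eqxx ?orbT.
  have [->//|posX] := posnP #|~: X|.
  have oddX := noeven X aX bX indX cX posX.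
  have [le6|gt6] := leqP #|~: X| 6.
    by move: le6 oddX; case: #|~: X| => [|[|[|[|[|[|[|]]]]]]].
  case: (boolP [exists S : {set G}, [&& [disjoint S & X], #|S| \in [:: 1; 3; 5]
     & indec_on (S :|: X)]]) => [/existsP[S /and3P[SX cS indS]]|].
    (* If [S :|: X] is everything, [#|~: X|] is [#|S|], at most 5. Otherwise its complement is odd
       by [noeven], and so is [#|S|], which makes [#|~: X|] even. *)
    have cSX : #|~: X| = #|S| + #|~: (S :|: X)|.
      rewrite -(cardsID S) setDE setIC setCU (setIC (~: S)).
      by rewrite (setIidPl _) // -disjoints_subset.
    have sX : X \subset S :|: X := subsetUr _ _.
    have oddSX := noeven (S :|: X) (subsetP sX _ aX) (subsetP sX _ bX) indS
      (leq_trans cX (subset_leq_card sX)).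
    move: gt6 oddX cS; rewrite cSX oddD !inE.
    have [->|/oddSX ->] := posnP #|~: (S :|: X)|.
      by rewrite addn0 => + _ /or3P[]/eqP e; rewrite e.
    by move=> _ + /or3P[]/eqP e; rewrite e.
  rewrite negb_exists => /forallP noS.
  suff : ~~ odd #|~: X| by rewrite oddX.
  apply: (even_card_outside aX indT indX cX) => S SX cS.
  by move: (noS S); rewrite SX cS.
split=> //.
- by rewrite indecomposable_induced.
- have := indec_on_card_neq3 indX; rewrite card_sig => n3.
  by rewrite ltn_neqAle eq_sym n3.
move=> X' pX' aX' bX' cX'; rewrite /decomposable indecomposable_induced indec_on_val.
(* The image of [X'] under [val] would satisfy [P] and be smaller than [X]. *)
apply/negP => ind; have := minX (val @: X'); rewrite /P ind card_imset; last exact: val_inj.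
rewrite cX' (imset_f val aX') (imset_f val bX') => /(_ isT).
rewrite leqNgt => /negP[]; apply: leq_trans (proper_card pX') _.
by rewrite cardsT card_sig.
Qed.
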